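(* Let $n\geq 2$ be an integer and let $X$ be an $n$-Urysohn topological space. Then $|X|\leq d(X)^{\,\pi\chi(X)\cdot n\text{-}\psi_c(X)}$.
   Context: Throughout $n\ge 2$ is an integer. The Urysohn number $U(X)$ of a space $X$ is the least cardinal $\kappa$ such that for every $A\subseteq X$ with $|A|\geq\kappa$ there exist open neighbourhoods $U_a$ of $a$ ($a\in A$) with $\bigcap_{a\in A}\overline{U_a}=\emptyset$. $X$ is $n$-Urysohn if $U(X)\leq n$. For an $n$-Urysohn space $X$, the $n$-closed pseudocharacter $n\text{-}\psi_c(X)$ is the minimum infinite cardinal $\kappa$ such that for each point $x\in X$ there is a collection $\{V(\alpha,x):\alpha<\kappa\}$ of open neighbourhoods of $x$ such that whenever $x_1,\dots,x_n\in X$ are $n$ different points, $\bigcap_{\alpha<\kappa}\overline{V(\alpha,x_1)}\cap\dots\cap\bigcap_{\alpha<\kappa}\overline{V(\alpha,x_n)}=\emptyset$. $d(X)$ is the density and $\pi\chi(X)$ the $\pi$-character of $X$, both multiplied by $\omega$ (so they are always infinite). *)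

(* Defs.v *)
From mathcomp Require Import all_boot all_classical.
From mathcomp Require Export topology.

Set Implicit Arguments.
Unset Strict Implicit.
Unset Printing Implicit Defensive.

Local Open Scope classical_set_scope.
Local Open Scope card_scope.

(* A cardinal number is represented by any type of that cardinality: products
   and powers of cardinals are product and function types. *)
Definition cardinal_le (K L : Type) : Prop := [set: K] #<= [set: L].

Lemma injective_cardinal_le (K L : Type) (f : K -> L) :
  injective f -> cardinal_le K L.
Proof.
move=> injf.
have /injfunPex[g] : exists2 g, set_fun [set: K] [set: L] g & set_inj [set: K] g.
  by exists f => // x y _ _; exact: injf.
exact: inj_card_le g.
Qed.

Lemma cardinal_le_trans (K L M : Type) :
  cardinal_le K L -> cardinal_le L M -> cardinal_le K M.
Proof. exact: card_le_trans. Qed.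

Lemma least_cardinal_family (I : Type) (F : I -> Type) (i0 : I) :
  exists i, forall j, cardinal_le (F i) (F j).
Proof.
pose T := forall i, F i.
pose good (M : set T) := forall i (f g : T), M f -> M g -> f i = g i -> f = g.
have [] := @Zorn_bigcup T good.
  move=> G Ggood Gtot i f g [M GM Mf] [N GN Ng].
  have [MN|NM] := Gtot _ _ GM GN.
    by apply: (Ggood _ GN i) => //; exact: MN.
  by apply: (Ggood _ GM i) => //; exact: NM.
move=> M [goodM maxM].
have [i onto] : exists i, forall y : F i, exists2 f, M f & f i = y.
  apply: contrapT => no.
  have miss i : exists y : F i, forall f, M f -> f i <> y.
    apply: contrapT => /forallNP h; apply: no; exists i => y.
    by have /existsNP[f /not_implyP[Mf /contrapT fy]] := h y; exists f.
  pose f0 : T := fun i => projT1 (cid (miss i)).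
  have f0P i f : M f -> f i <> f0 i.
    by rewrite /f0; case: cid => y /= /(_ f).
  apply: (maxM (M `|` [set f0])).
    split; first by move=> f Mf; left.
    move=> /(_ f0 (or_intror erefl)) Mf0.
    exact: (f0P i0 f0).
  move=> i f g [Mf|->] [Mg|->] //.
  - exact: goodM.
  - by move=> fg; case: (f0P i _ Mf).
  - by move=> fg; case: (f0P i _ Mg).
exists i => j.
have [s sP] : exists s : F i -> T, forall y, M (s y) /\ s y i = y.
  by exists (fun y => projT1 (cid2 (onto y))) => y; case: cid2.
apply: (@injective_cardinal_le _ _ (fun y => s y j)) => y z yz.
have [[My sy] [Mz sz]] := (sP y, sP z).
by rewrite -sy -sz (goodM j _ _ My Mz yz).
Qed.

Lemma cardinal_le_total (K L : Type) : cardinal_le K L \/ cardinal_le L K.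
Proof.
have [[] h] := least_cardinal_family (fun b : bool => if b then K else L) true.
- by left; exact: (h false).
- by right; exact: (h true).
Qed.

Definition is_least_cardinal (P : Type -> Prop) (K : Type) : Prop :=
  P K /\ forall L : Type, P L -> cardinal_le K L.

(* [void] is only a default value for an unsatisfiable [P]: see
   [least_cardinalP]. *)
Definition least_cardinal (P : Type -> Prop) : Type :=
  match pselect (exists K, is_least_cardinal P K) with
  | left ex => projT1 (cid ex)
  | right _ => void
  end.

(* The cardinals below [K0] are compared through the subsets of [K0], which keeps
   the universe of [P] unconstrained. *)
Lemma exists_least_cardinal (P : Type -> Prop) :
  (exists K, P K) -> exists K, is_least_cardinal P K.
Proof.
move=> [K0 PK0].
pose below (A : set K0) :=
  exists2 L : Type, P L & cardinal_le L {x | A x} /\ cardinal_le {x | A x} L.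
have belowP (L : Type) : P L -> cardinal_le L K0 ->
    exists A : {A | below A}, cardinal_le {x | sval A x} L.
  move=> PL /card_leP[f].
  pose g (y : L) : K0 := \val (f (to_setT y)).
  have g_inj : injective g.
    move=> x y /val_inj.
    have h : injective f by move=> u v; apply: inj; rewrite in_setE.
    by move=> /h /(congr1 val).
  have gL : cardinal_le L {x | range g x}.
    apply: (@injective_cardinal_le _ _
      (fun y => exist (range g) (g y) (ex_intro2 _ _ y I erefl))).
    by move=> x y [] /g_inj.
  have Lg : cardinal_le {x | range g x} L.
    pose h (z : {x | range g x}) : L := projT1 (cid2 (projT2 z)).
    have hP z : g (h z) = sval z by rewrite /h; case: cid2.
    apply: (@injective_cardinal_le _ _ h) => u v uv.
    have {uv} : sval u = sval v by rewrite -!hP uv.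
    by case: u v => x p [y q] /=; exact: eq_exist.
  by exists (exist below (range g) (ex_intro2 _ _ L PL (conj gL Lg))).
have [A0 _] := belowP K0 PK0 (card_lexx _).
have [[A [L PL [LA AL]]] minA] :=
  least_cardinal_family (fun A : {A | below A} => {x | sval A x}) A0.
exists L; split=> // L' PL'.
have le_below (L1 : Type) : P L1 -> cardinal_le L1 K0 -> cardinal_le L L1.
  move=> PL1 /(belowP _ PL1)[B BL1].
  exact: cardinal_le_trans LA (cardinal_le_trans (minA B) BL1).
have [|K0L'] := cardinal_le_total L' K0; first exact: le_below.
exact: cardinal_le_trans (le_below _ PK0 (card_lexx _)) K0L'.
Qed.

Lemma least_cardinalP (P : Type -> Prop) :
  (exists K, P K) -> is_least_cardinal P (least_cardinal P).
Proof.
move=> /exists_least_cardinal ex; rewrite /least_cardinal.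
by case: pselect => // ex'; case: cid.
Qed.

Definition urysohn_number (X : topologicalType) : Type :=
  least_cardinal (fun K => forall A : set X, [set: K] #<= A ->
    exists2 U : X -> set X,
      forall a, A a -> open_nbhs a (U a) & \bigcap_(a in A) closure (U a) = set0).

Definition n_urysohn (n : nat) (X : topologicalType) : Prop :=
  [set: urysohn_number X] #<= `I_n.

(* [K] indexes the neighbourhoods, so [V x alpha] is the paper's V(alpha, x). *)
Definition closed_pseudocharacter (n : nat) (X : topologicalType) : Type :=
  least_cardinal (fun K => infinite_set [set: K] /\
    exists2 V : X -> K -> set X,
      forall x alpha, open_nbhs x (V x alpha) &
      forall x : 'I_n -> X, injective x ->
        \bigcap_(i in [set: 'I_n])
          \bigcap_(alpha in [set: K]) closure (V (x i) alpha) = set0).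

Definition density (X : topologicalType) : Type :=
  least_cardinal (fun K => exists2 D : set X, dense D & [set: K] #= D) * nat.

Definition local_pi_base (X : topologicalType) (x : X) (B : set (set X)) : Prop :=
  (forall W, B W -> open W /\ W !=set0) /\
  (forall U, open_nbhs x U -> exists2 W, B W & W `<=` U).

Definition local_pi_character (X : topologicalType) (x : X) : Type :=
  least_cardinal (fun K => exists2 B, local_pi_base x B & [set: K] #= B).

(* The inner least cardinal is the supremum of the local pi-characters. *)
Definition pi_character (X : topologicalType) : Type :=
  least_cardinal (fun K => forall x : X, cardinal_le (local_pi_character x) K)
  * nat.

(* Main.v *)
Require Import Defs.
From mathcomp Require Import all_boot all_classical topology.

Set Implicit Arguments.
Unset Strict Implicit.
Unset Printing Implicit Defensive.

(** Let [g : K -> X] enumerate a dense set of least cardinality and give each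
   point [x] neighbourhoods [V x alpha] witnessing the closed pseudocharacter and
   a local pi-base of cardinality at most the pi-character.  Picking a point of
   the dense set in every member of the local pi-base of [x] that lies inside
   [V x alpha] gives a set contained in [V x alpha] whose closure contains [x];
   it is enumerated by [g \o F (x, alpha)], where [F (x, alpha)] is a function
   from the pi-character to [K] ([pi_base_enumeration]).

   If [n] points [x_i] have the same functions [F (x_i, _)], then each of them
   lies in the closure of every [V x_i alpha], so the [x_i] are not pairwise
   distinct by the choice of [V].  Hence the fibres of [x |-> F (x, _)] are
   finite.  Since the density carries a factor [nat], pairing [F (x, _)] with a
   number that identifies [x] in its fibre ([fibrewise_index]) gives the required
   injection.

   The least cardinals involved must also be attained.  For the Urysohn number
   this is Cantor's theorem: no subset of [X] is as large as the power set of [X].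
   For the closed pseudocharacter it uses that [X] is n-Urysohn: the family of
   all open neighbourhoods of each point then works. *)

Local Open Scope classical_set_scope.
Local Open Scope card_scope.

Lemma card_le_range (T K : Type) (A : set T) :
  A !=set0 -> A #<= [set: K] -> exists g : K -> T, range g = A.
Proof.
move=> /set0P/eqP A0 /pfcard_geP[//|[g]]; exists g.
apply/seteqP; split; last exact: surj.
by move=> _ [k _ <-]; exact: funS.
Qed.

(** Cantor's theorem: a surjection from [T] to its subsets would miss its diagonal
   set. *)
Lemma not_power_set_le (T : Type) (A : set T) : ~ ([set: set T] #<= A).
Proof.
move=> le_A.
have ne0 : [set: set T] !=set0 by exists set0.
have [g onto] := card_le_range ne0 (card_le_trans le_A (card_leT A)).
have [t _ gt] : range g [set x | ~ g x x] by rewrite onto.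
have gtt : g t t = ~ g t t by rewrite [in LHS]gt.
have nt : ~ g t t by move=> h; have := h; rewrite gtt.
by apply: (nt); rewrite gtt.
Qed.

Lemma range_ord_card (T : Type) (n : nat) (x : 'I_n -> T) :
  injective x -> range x #= `I_n.
Proof.
move=> x_inj; apply: (card_eq_trans (inj_card_eq _) (card_esym card_II)).
by move=> i j _ _; exact: x_inj.
Qed.

Lemma card_le_injection (K T : Type) (A : set T) :
  [set: K] #<= A -> exists2 g : K -> T, injective g & forall k, A (g k).
Proof.
move=> /card_leP[f]; exists (fun k => \val (f (to_setT k))).
  move=> k l /val_inj.
  have f_inj : injective f by move=> u v; apply: inj; rewrite in_setE.
  by move=> /f_inj /(congr1 val).
by move=> k; exact: set_valP.
Qed.

(** A set without [n] distinct points is finite; so if no [n] distinct points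
   share a value of [F], the points of each fibre of [F] can be numbered. *)
Lemma fibrewise_index (T C : Type) (n : nat) (F : T -> C) :
  (forall x : 'I_n -> T, injective x -> ~ (forall i j, F (x i) = F (x j))) ->
  exists idx : T -> nat, forall x y, F x = F y -> idx x = idx y -> x = y.
Proof.
move=> no_n.
have numbered c : exists f : T -> nat, {in F @^-1` [set c] &, injective f}.
  apply/countable_injP/finite_set_countable.
  apply: contrapT => fibre_inf.
  have [g g_inj Fg] := card_le_injection ((infiniteP _).1 fibre_inf).
  apply: (no_n (fun i : 'I_n => g i)) => [i j /g_inj/ord_inj //|i j].
  by rewrite [LHS]Fg [RHS]Fg.
have [f f_inj] := choice numbered.
exists (fun x => f (F x) x) => x y Fxy; rewrite Fxy.
by apply: f_inj; rewrite in_setE.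
Qed.

Lemma densityP (X : topologicalType) :
  [set: X] !=set0 ->
  exists (K : Type) (g : K -> X),
    density X = (K * nat)%type /\ dense (range g).
Proof.
move=> X0; set P := fun K : Type => exists2 D : set X, dense D & [set: K] #= D.
have [|[D D_dense /card_eqPle[_ D_le]] _] := @least_cardinalP P.
  exists X, [set: X]; last exact: card_eqxx.
  by move=> O [x Ox] _; exists x.
have D0 : D !=set0.
  by have [x [_ Dx]] := D_dense _ X0 openT; exists x.
have [g gD] := card_le_range D0 D_le.
by exists (least_cardinal P), g; rewrite gD.
Qed.

Lemma local_pi_characterP (X : topologicalType) (x : X) :
  exists2 B, local_pi_base x B & [set: local_pi_character x] #= B.
Proof.
set P := fun K : Type => exists2 B, local_pi_base x B & [set: K] #= B.
have [|//] := @least_cardinalP P.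
pose B := [set W : set X | open W /\ W !=set0].
exists B, B; last exact: card_setT.
split=> // U [oU Ux]; exists U => //.
by split=> //; exists x.
Qed.

(** All local pi-bases can be indexed by one type, since each of them is a subset
   of [set X]. *)
Lemma pi_characterP (X : topologicalType) :
  exists K : Type, pi_character X = (K * nat)%type /\
    forall x : X, exists2 B, local_pi_base x B & B #<= [set: K].
Proof.
set P := fun K : Type => forall x : X, cardinal_le (local_pi_character x) K.
have [|leK _] := @least_cardinalP P.
  exists (set X) => x.
  have [B _ /card_eqPle[le_B _]] := local_pi_characterP x.
  exact: card_le_trans le_B (card_leT B).
exists (least_cardinal P); split=> // x.
have [B Bx /card_eqPle[_ B_le]] := local_pi_characterP x.
by exists B => //; exact: card_le_trans B_le (leK x).
Qed.

(** The power set of [X] satisfies the condition on the Urysohn number vacuously,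
   so the number is attained. *)
Lemma urysohn_numberP (X : topologicalType) (A : set X) :
  [set: urysohn_number X] #<= A ->
  exists2 U : X -> set X,
    forall a, A a -> open_nbhs a (U a) & \bigcap_(a in A) closure (U a) = set0.
Proof.
set P := fun K : Type => forall A : set X, [set: K] #<= A ->
  exists2 U : X -> set X,
    forall a, A a -> open_nbhs a (U a) & \bigcap_(a in A) closure (U a) = set0.
have [|PU _] := @least_cardinalP P; last exact: PU.
by exists (set X) => B /not_power_set_le.
Qed.

Lemma n_urysohn_separated (n : nat) (X : topologicalType) (x : 'I_n -> X) :
  n_urysohn n X -> injective x ->
  exists2 U : X -> set X, forall i, open_nbhs (x i) (U (x i)) &
    \bigcap_i closure (U (x i)) = set0.
Proof.
move=> X_n x_inj.
have [|U U_nbhs U0] := @urysohn_numberP X (range x).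
  have /card_eqPle[_] := range_ord_card x_inj.
  exact: card_le_trans.
exists U => [i|]; first by apply: U_nbhs; exists i.
by rewrite -U0 bigcap_image.
Qed.

Lemma closed_pseudocharacterP (n : nat) (X : topologicalType) :
  n_urysohn n X ->
  infinite_set [set: closed_pseudocharacter n X] /\
  exists2 V : X -> closed_pseudocharacter n X -> set X,
    forall x alpha, open_nbhs x (V x alpha) &
    forall x : 'I_n -> X, injective x ->
      \bigcap_i \bigcap_alpha closure (V (x i) alpha) = set0.
Proof.
move=> X_n; set P := fun K : Type => infinite_set [set: K] /\
    exists2 V : X -> K -> set X,
      forall x alpha, open_nbhs x (V x alpha) &
      forall x : 'I_n -> X, injective x ->
        \bigcap_(i in [set: 'I_n])
          \bigcap_(alpha in [set: K]) closure (V (x i) alpha) = set0.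
suff P_ex : exists K, P K by have [] := least_cardinalP P_ex.
(* The factor [nat] only makes the index type infinite. *)
exists (set X * nat)%type; split.
  apply/infiniteP; apply: (@injective_cardinal_le _ _ (fun k => (set0, k))).
  by move=> k l [].
(* Each set [U] is an index: it stands for itself at the points of which it is an
   open neighbourhood, and for the whole space at the others. *)
exists (fun x alpha => if pselect (open_nbhs x alpha.1) then alpha.1 else setT).
  move=> x alpha; case: pselect => //= _.
  by split=> //; exact: openT.
move=> x x_inj.
have [U U_nbhs U0] := n_urysohn_separated X_n x_inj.
rewrite -subset0 => z Vz; rewrite -U0 => i _.
have := Vz i I (U (x i), 0%N) I => /=.
by case: pselect => // /(_ (U_nbhs i)).
Qed.

(** Inside an open neighbourhood [V] of [x], points of a dense set chosen in the
   members of a local pi-base at [x] accumulate at [x]. *)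
Lemma pi_base_enumeration (X : topologicalType) (K L : Type) (g : K -> X)
    (x : X) (B : set (set X)) (V : set X) :
  dense (range g) -> local_pi_base x B -> B #<= [set: L] -> open_nbhs x V ->
  exists2 f : L -> K, range (g \o f) `<=` V & closure (range (g \o f)) x.
Proof.
move=> g_dense [B_open B_base] B_le V_nbhs.
pose C := [set W | B W /\ W `<=` V].
have C0 : C !=set0 by have [W BW WV] := B_base V V_nbhs; exists W.
have C_le : C #<= [set: L].
  by apply: card_le_trans B_le; apply: subset_card_le => W [].
have [w wC] := card_le_range C0 C_le.
have wP l : C (w l) by rewrite -wC; exists l.
have pick l : exists k, w l (g k).
  have [/B_open[ow w0] _] := wP l.
  by have [y [wy [k _ gk]]] := g_dense _ w0 ow; exists k; rewrite gk.
have [f fP] := choice pick; exists f.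
  by move=> _ [l _ <-]; exact: (wP l).2 (fP l).
move=> N; rewrite nbhsE => -[O O_nbhs ON].
have [W BW WOV] : exists2 W, B W & W `<=` O `&` V.
  by apply: B_base; apply: open_nbhsI.
have [l _ wl] : range w W by rewrite wC; split=> // y /WOV[].
exists (g (f l)); split; first by exists l.
by apply: ON; have := fP l; rewrite wl => /WOV[].
Qed.

Theorem theorem3p16 (n : nat) (X : topologicalType)
    (n_ge2 : (2 <= n)%N) (X_n_urysohn : n_urysohn n X) :
  cardinal_le X (pi_character X * closed_pseudocharacter n X -> density X).
Proof.
have [X0|/set0P X0] := eqVneq [set: X] set0.
  by rewrite /cardinal_le X0 card_ge0.
have [K [g [-> g_dense]]] := densityP X0.
have [L [-> pi_base]] := pi_characterP X.
have [M_inf [V V_nbhs V0]] := closed_pseudocharacterP X_n_urysohn.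
move: (closed_pseudocharacter n X) M_inf V V_nbhs V0 => M M_inf V V_nbhs V0.
have enum (xa : X * M) : exists f : L -> K,
    range (g \o f) `<=` V xa.1 xa.2 /\ closure (range (g \o f)) xa.1.
  have [B B_base B_le] := pi_base xa.1.
  have [f] := pi_base_enumeration g_dense B_base B_le (V_nbhs xa.1 xa.2).
  by exists f.
have {enum}[F FP] := choice enum.
have [idx idx_inj] : exists idx : X -> nat, forall x y,
    (fun alpha => F (x, alpha)) = (fun alpha => F (y, alpha)) ->
    idx x = idx y -> x = y.
  apply: (@fibrewise_index _ _ n) => x x_inj Fx.
  have i0 : 'I_n by exists 0%N; exact: ltnW.
  suff : set0 (x i0) by [].
  rewrite -(V0 x x_inj) => i _ alpha _.
  have [FV _] := FP (x i, alpha); have [_ cl] := FP (x i0, alpha).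
  apply: (closureS FV).
  by rewrite (congr1 (fun h => h alpha) (Fx i i0) : F (x i, alpha) = _).
apply: (@injective_cardinal_le _ _ (fun x (p : L * nat * M) =>
  (F (x, p.2) p.1.1, idx x))) => x y Gxy.
have Gp l alpha : (F (x, alpha) l, idx x) = (F (y, alpha) l, idx y).
  exact: (congr1 (fun h => h (l, 0%N, alpha)) Gxy).
have [alpha0 _] := infinite_setN0 M_inf.
(* [idx x] is read off at any index: [M] is infinite, and [L] is inhabited because
   it indexes a set with [x] in its closure. *)
have [_ clx] := FP (x, alpha0).
have [_ [[l0 _ _] _]] := clx setT filterT.
apply: idx_inj; last by case: (Gp l0 alpha0).
by apply/funext => alpha; apply/funext => l; case: (Gp l alpha).
Qed.
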